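(* Let $r$ and $s$ be positive integers with $r \geq s \geq 3$. If $\lfloor \frac{5s-1}{3} \rfloor - 1 < r \leq 2s - 2$, then $f(s,r,3) = 4s + 3r - 4$.
   Context: For integers $a\le b$, $[a,b]=\{n\in\mathbb{N} : a\le n\le b\}$. For a finite set $X\subseteq\mathbb{N}$, $\mathrm{diam}(X)=\max(X)-\min(X)$. $f(s,r,3)$ denotes the smallest positive integer $n$ such that for every coloring $\Delta:[1,n]\to\{1,2,3\}$ there exist subsets $S_1,S_2\subseteq[1,n]$ with: (a) $S_1$ and $S_2$ each monochromatic (not necessarily of the same color); (b) $|S_1|=s$, $|S_2|=r$; (c) $\max(S_1)<\min(S_2)$; (d) $\mathrm{diam}(S_1)\le\mathrm{diam}(S_2)$. *)

(* Defs.v *)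
From mathcomp Require Import all_boot finmap.
Set Implicit Arguments.
Unset Strict Implicit.
Unset Printing Implicit Defensive.
Local Open Scope fset_scope.

Definition interval (a b : nat) : {fset nat} := [fset x | x in iota a (b.+1 - a)].

(* On the empty set, [fmax], [fmin] and [diam] are all 0. *)
Definition fmax (X : {fset nat}) : nat := \max_(x <- X) x.
Definition fmin (X : {fset nat}) : nat := \big[minn/fmax X]_(x <- X) x.
Definition diam (X : {fset nat}) : nat := fmax X - fmin X.

Definition monochromatic (k : nat) (Delta : nat -> 'I_k) (X : {fset nat}) : Prop :=
  exists c : 'I_k, forall x, x \in X -> Delta x = c.

(* A coloring of [1,n] is represented by a total function on nat; only its
   values on [1,n] matter, as S1 and S2 are subsets of [1,n]. *)
Definition f_prop (s r k n : nat) : Prop :=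
  forall Delta : nat -> 'I_k,
  exists S1 S2 : {fset nat},
    [/\ S1 `<=` interval 1 n /\ S2 `<=` interval 1 n,
        monochromatic Delta S1 /\ monochromatic Delta S2,
        #|` S1| = s /\ #|` S2| = r,
        fmax S1 < fmin S2 &
        diam S1 <= diam S2].

(* [is_f s r k n] means f(s,r,k) = n.  A relation is used because f(s,r,k) need
   not exist for all parameters: for r = 1 < s, diam(S1) <= diam(S2) always fails. *)
Definition is_f (s r k n : nat) : Prop :=
  [/\ 0 < n, f_prop s r k n &
      forall m, 0 < m -> f_prop s r k m -> n <= m].

(* Main.v *)
Require Import Defs.
From mathcomp Require Import all_boot finmap.
From mathcomp Require Import zify.
From Stdlib Require Import Classical_Prop.
Set Implicit Arguments.
Unset Strict Implicit.
Unset Printing Implicit Defensive.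

(** Upper bound.  The first [3s-2] integers contain a monochromatic [s]-set, so
    in the remaining interval [Q], of length [s+3r-2], a color used at least [r]
    times (a heavy color) spans at most [3s-3] consecutive integers.  One heavy
    color: it has at least [s+r] elements in [Q], and splitting them after the
    first [s] works as [2r > 3s-4].  Two heavy colors [A], [B], with [A] starting
    first: the first [s] elements of [A] precede [B], hence are wider than [B];
    this confines [B] to a short final segment and forces [A] to span at least
    [2r > 3s-3] integers.  Three heavy colors: one lies at the start, one at the
    end, and between them the third has [s] consecutive integers.

    Lower bound.  The word [A B^(s-1) C^(s-1) A^(s-1) B^(s+r-1) A^(r-1) C^(r-1)]
    of length [4s+3r-5] contains no admissible pair. *)

(** * Extrema and cardinalities of finite sets of integers *)

Lemma mem_interval a b x : (x \in interval a b) = (a <= x <= b).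
Proof. by rewrite inE /= mem_iota; lia. Qed.

Lemma fmax_ge (X : {fset nat}) x : x \in X -> x <= fmax X.
Proof. by move=> xX; apply: (@leq_bigmax_seq _ (X : seq nat) xpredT id). Qed.

Lemma fmax_le (X : {fset nat}) b : (forall x, x \in X -> x <= b) -> fmax X <= b.
Proof. by move=> Xb; apply/bigmax_leqP_seq => x xX _; apply: Xb. Qed.

Lemma fmin_le (X : {fset nat}) x : x \in X -> fmin X <= x.
Proof.
rewrite /fmin; move: (fmax X) => m.
change ((x \in (X : seq nat)) -> \big[minn/m]_(y <- X) y <= x).
elim: (X : seq nat) => //= y t IH; rewrite big_cons inE => /orP[/eqP->|/IH]; lia.
Qed.

Lemma fmin_ge (X : {fset nat}) a x :
  x \in X -> (forall y, y \in X -> a <= y) -> a <= fmin X.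
Proof.
move=> xX Xa; rewrite /fmin.
(* The default value [fmax X] of the iterated minimum must be at least [a] too; the witness [x]
   provides this. *)
have := leq_trans (Xa x xX) (fmax_ge xX); move: (fmax X) => m am.
rewrite big_seq; apply: (big_ind (leq a)) => [//|y z|i iX]; [lia|exact: Xa].
Qed.

(** In each range examined below, a letter of the extremal word occupies at most two blocks; [0 - 0]
    stands for an absent second one. *)
Lemma card_two_intervals (X : {fset nat}) a b c d :
  (forall x, x \in X -> a <= x < b \/ c <= x < d) ->
  #|` X|%fset <= (b - a) + (d - c).
Proof.
move=> Xsub.
rewrite -[b - a](size_iota a) -[d - c](size_iota c) -size_cat.
by apply: uniq_leq_size (fset_uniq X) _ => x /Xsub; rewrite mem_cat !mem_iota; lia.
Qed.

(** * Lower bound: the extremal word, with letters A, B, C coded 0, 1, 2 *)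

Definition extremal (s r x : nat) : nat :=
  if x <= 1 then 0 else
  if x <= s then 1 else
  if x <= 2 * s - 1 then 2 else
  if x <= 3 * s - 2 then 0 else
  if x <= 4 * s + r - 3 then 1 else
  if x <= 4 * s + 2 * r - 4 then 0 else 2.

Lemma extremal_lt3 s r x : extremal s r x < 3.
Proof. by rewrite /extremal; do 6! case: ifP => // _. Qed.

Lemma extremal_class s r x : 1 <= s ->
  match extremal s r x with
  | 0 => [\/ x <= 1, 2 * s <= x /\ x + 2 <= 3 * s |
             4 * s + r <= x + 2 /\ x + 4 <= 4 * s + 2 * r]
  | 1 => 2 <= x /\ x <= s \/ 3 * s <= x + 1 /\ x + 3 <= 4 * s + r
  | _ => s < x /\ x < 2 * s \/ 4 * s + 2 * r <= x + 3
  end.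
Proof.
rewrite /extremal => hs.
case: ifP => h1; first by constructor 1.
case: ifP => h2; first by left; lia.
case: ifP => h3; first by left; lia.
case: ifP => h4; first by constructor 2; lia.
case: ifP => h5; first by right; lia.
case: ifP => h6; first by constructor 3; lia.
by right; lia.
Qed.

Lemma f_prop_lower_bound s r m :
  2 <= s -> s <= r -> r <= 2 * s - 2 -> f_prop s r 3 m ->
  4 * s + 3 * r - 4 <= m.
Proof.
move=> hs hrs hup hm; rewrite leqNgt; apply/negP => ltm.
have {}ltm : m + 5 <= 4 * s + 3 * r by lia.
have {}hup : r + 2 <= 2 * s by lia.
have [S1 [S2 [[sub1 sub2] [[c1 mono1] [c2 mono2]] [card1 card2] lt12 ledm]]] :=
  hm (fun x => inord (extremal s r x)).
have mono c (S : {fset nat}) : fsubset S (interval 1 m) ->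
    (forall x, x \in S -> inord (extremal s r x) = c :> 'I_3) ->
    forall x, x \in S -> [/\ extremal s r x = c, 1 <= x, x <= m, fmin S <= x & x <= fmax S].
  move=> sub mc x xS; have := fsubsetP sub x xS; rewrite mem_interval => /andP[x1 xm].
  split=> //; [|exact: fmin_le|exact: fmax_ge].
  by rewrite -(mc x xS) inordK // extremal_lt3.
have {sub1 mono1}M1 x (xS : x \in S1) := mono _ _ sub1 mono1 x xS.
have {sub2 mono2 mono}M2 x (xS : x \in S2) := mono _ _ sub2 mono2 x xS.
have C1 a b c d := @card_two_intervals S1 a b c d.
have C2 a b c d := @card_two_intervals S2 a b c d.
rewrite card1 in C1; rewrite card2 in C2; rewrite /diam in ledm.
move: (@fmax_le S2) => maxS2.
move: (fmax S1) (fmin S1) (fmax S2) (fmin S2) lt12 ledm M1 M2 maxS2.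
move=> u t w v lt12 ledm M1 M2 maxS2.
have cls x := extremal_class r x (ltnW hs).
(* Up to position 3s-3 each letter occurs at most s-1 times. *)
have u_large : 3 * s <= u + 2.
  clear ledm; rewrite leqNgt; apply/negP => lu.
  case: c1 M1 => [[|[|[|//]]] /= _] M1.
  - suff : s <= (2 - 1) + (u.+1 - 2 * s) by lia.
    apply: C1 => x /M1[e x1 xm tx xu]; move: (cls x); rewrite e.
    by case=> [?|[? ?]|[? ?]]; lia.
  - suff : s <= (s.+1 - 2) + (0 - 0) by lia.
    apply: C1 => x /M1[e x1 xm tx xu]; move: (cls x); rewrite e.
    by case=> [[? ?]|[? ?]]; lia.
  - suff : s <= (2 * s - s.+1) + (0 - 0) by lia.
    apply: C1 => x /M1[e x1 xm tx xu]; move: (cls x); rewrite e.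
    by case=> [[? ?]|?]; lia.
(* After position 3s-2 the letters A and C occur at most r-1 times each, so [S2] lies in the block
   B^(s+r-1). *)
have {M2}M2 x : x \in S2 -> 3 * s <= x + 1 /\ x + 3 <= 4 * s + r /\ u < x.
  move: x; case: c2 M2 => [[|[|[|//]]] /= _] M2.
  - suff : r <= (4 * s + 2 * r - 3 - (4 * s + r - 2)) + (0 - 0) by lia.
    clear ledm; apply: C2 => x /M2[e x1 xm tx xu]; move: (cls x); rewrite e.
    by case=> [?|[? ?]|[? ?]]; lia.
  - move=> x /M2[e x1 xm tx xu]; move: (cls x); rewrite e.
    by case=> [[? ?]|[? ?]]; lia.
  - suff : r <= (m.+1 - (4 * s + 2 * r - 3)) + (0 - 0) by lia.
    clear ledm; apply: C2 => x /M2[e x1 xm tx xu]; move: (cls x); rewrite e.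
    by case=> [[? ?]|?]; lia.
have u_small : u + 3 <= 4 * s.
  suff : r <= (4 * s + r - 2 - u.+1) + (0 - 0) by lia.
  by clear ledm; apply: C2 => x /M2 ?; lia.
have w_small : w <= 4 * s + r - 3 by apply: maxS2 => x /M2 ?; lia.
(* [S2] has diameter at most (4s+r-3)-(3s-1) = s+r-2 <= 3s-4. But [S1] has diameter at least 3s-3:
   in color A it needs position 1, in color B it straddles the gap of 2s-2 positions between two
   blocks. Color C occurs only s-1 times up to [u]. *)
case: c1 M1 => [[|[|[|//]]] /= _] M1.
- suff : s <= (2 - maxn t 1) + (minn u.+1 (3 * s - 1) - 2 * s) by lia.
  clear ledm; apply: C1 => x /M1[e x1 xm tx xu]; move: (cls x); rewrite e.
  by case=> [?|[? ?]|[? ?]]; lia.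
- suff : s <= (s.+1 - t) + (u.+1 - (3 * s - 1)) by lia.
  clear ledm; apply: C1 => x /M1[e x1 xm tx xu]; move: (cls x); rewrite e.
  by case=> [[? ?]|[? ?]]; lia.
- suff : s <= (2 * s - s.+1) + (0 - 0) by lia.
  clear ledm; apply: C1 => x /M1[e x1 xm tx xu]; move: (cls x); rewrite e.
  by case=> [[? ?]|?]; lia.
Qed.

(** * Upper bound: counting colors on initial segments *)

Definition cumul k (Delta : nat -> 'I_k) (c : 'I_k) (x : nat) : nat :=
  count (fun y => Delta y == c) (iota 0 x).

Lemma cumulS k (Delta : nat -> 'I_k) c x :
  cumul Delta c x.+1 = cumul Delta c x + (Delta x == c).
Proof. by rewrite /cumul -addn1 iotaD count_cat /= addn0. Qed.

Lemma cumul_le k (Delta : nat -> 'I_k) c x y :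
  x <= y -> cumul Delta c x <= cumul Delta c y.
Proof.
move=> /subnK <-; elim: (y - x) => [//|n IH]; rewrite addSn cumulS; lia.
Qed.

(** Position 0 is counted as well, so the total is exactly [x]; only differences of counts matter
    later. *)
Lemma cumul_sum (Delta : nat -> 'I_3) A B C : uniq [:: A; B; C] ->
  forall x, cumul Delta A x + cumul Delta B x + cumul Delta C x = x.
Proof.
move=> /= uABC; elim=> [//|x IH]; rewrite !cumulS.
suff : (Delta x == A) + (Delta x == B) + (Delta x == C) = 1 by lia.
move: (Delta x) A B C uABC {IH} => [d ?] [a ?] [b ?] [c ?].
by rewrite !inE -!val_eqE /=; lia.
Qed.

(** A discrete intermediate value principle, used to pick the first, last or s-th element of a
    color. *)
Lemma cumul_index k (Delta : nat -> 'I_k) c i y :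
  i < cumul Delta c y ->
  exists x, [/\ x < y, Delta x = c & cumul Delta c x = i].
Proof.
elim: y => [//|y IH]; rewrite cumulS.
have [/IH[x [? ? ?]] _|ge] := ltnP i (cumul Delta c y).
  by exists x; split=> //; lia.
by case: eqP => [yc|_] ?; [exists y; split=> //; lia|lia].
Qed.

Lemma count_iota_cumul k (Delta : nat -> 'I_k) c a b : a <= b ->
  count (fun y => Delta y == c) (iota a (b - a)) = cumul Delta c b - cumul Delta c a.
Proof.
move=> ab; rewrite {1}/cumul -{2}(subnKC ab) iotaD count_cat add0n.
rewrite -/(cumul Delta c a); lia.
Qed.

(** Taking the first [j] elements of the color guarantees that [a] is among them, which will fix the
    minimum of the second set. *)
Lemma subset_within k (Delta : nat -> 'I_k) c a b j :
  a <= b -> j + cumul Delta c a <= cumul Delta c b ->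
  exists2 S : {fset nat}, #|` S| = j /\ (0 < j -> Delta a = c -> a \in S) &
    forall x, x \in S -> a <= x < b /\ Delta x = c.
Proof.
move=> ab cab.
pose L := [seq x <- iota a (b - a) | Delta x == c].
exists [fset x in take j L]%fset.
  split.
    rewrite card_fseq undup_id ?take_uniq ?filter_uniq ?iota_uniq //.
    by rewrite size_take_min size_filter count_iota_cumul //; lia.
  move=> j0 ac; rewrite inE /= /L.
  have ltab : a < b by rewrite ltn_neqAle ab andbT; apply/eqP => e; rewrite e in cab; lia.
  by rewrite -(subnSK ltab) /= ac eqxx; case: (j) j0 => // j' _; rewrite /= inE eqxx.
move=> x; rewrite inE /= => /mem_take; rewrite mem_filter mem_iota => /andP[/eqP-> ?].
by split=> //; lia.
Qed.

(* Only the second interval needs endpoints of its color: the diameter of the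
   first set is bounded from above, that of the second from below. *)
Definition avoids k (Delta : nat -> 'I_k) (s r n : nat) : Prop :=
  forall c c' a b a' b', 1 <= a -> a <= b -> b < a' -> a' <= b' -> b' <= n ->
    cumul Delta c a + s <= cumul Delta c b.+1 ->
    Delta a' = c' -> Delta b' = c' ->
    cumul Delta c' a' + r <= cumul Delta c' b'.+1 ->
    b' - a' < b - a.

Lemma avoids_f_prop s r k n : 1 <= s -> 2 <= r ->
  (forall Delta : nat -> 'I_k, ~ avoids Delta s r n) -> f_prop s r k n.
Proof.
move=> hs hr hav Delta; apply: NNPP => nex; apply: (hav Delta).
move=> c c' a b a' b' a1 ab ba' ab' bn' hc ca' cb' hc'.
rewrite ltnNge; apply/negP => led; apply: nex.
have [|S1 [card1 _] sub1] := @subset_within _ Delta c a b.+1 s (leqW ab).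
  by rewrite addnC.
(* The second set is made of r-1 elements of [a', b'), among them [a'] because r >= 2, and of [b'].
   Containing both endpoints, it has diameter at least b'-a'. *)
have [|S2 [card2 a'S2] sub2] := @subset_within _ Delta c' a' b' r.-1 ab'.
  by move: hc'; rewrite cumulS cb' eqxx; lia.
have {}a'S2 : a' \in S2 by apply: a'S2 => //; lia.
have b'S2 : b' \notin S2 by apply/negP => /sub2[]; lia.
pose S := (b' |` S2)%fset.
have [x xS1] : exists x, x \in S1 by apply/fset0Pn; rewrite -cardfs_gt0; lia.
have subS y : y \in S -> [/\ a' <= y, y <= b' & Delta y = c'].
  by rewrite !inE => /orP[/eqP->|/sub2[? ?]]; split=> //; lia.
have min1 : a <= fmin S1 by apply: (fmin_ge xS1) => y /sub1[]; lia.
have max1 : fmax S1 <= b by apply: fmax_le => y /sub1[]; lia.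
have a'S : a' \in S by rewrite !inE a'S2 orbT.
have min2 : fmin S = a'.
  by apply/eqP; rewrite eqn_leq fmin_le //; apply: (fmin_ge a'S) => y /subS[].
have max2 : b' <= fmax S by apply: fmax_ge; rewrite !inE eqxx.
exists S1, S; split.
- split; apply/fsubsetP => y; rewrite mem_interval; first by move/sub1=> []; lia.
  by move/subS=> []; lia.
- by split; [exists c => y /sub1[]|exists c' => y /subS[]].
- by rewrite cardfsU1 b'S2 card1 card2; lia.
- lia.
- by rewrite /diam; lia.
Qed.

(** * Spans of heavy colors: the cases of one, two and three *)

(* [x] and [y] are the first and last points of color [c] in [q,n]. *)
Definition extent k (Delta : nat -> 'I_k) (q n : nat) (c : 'I_k) (x y : nat) : Prop :=
  [/\ q <= x, x <= y, y <= n, Delta x = c /\ Delta y = c &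
      cumul Delta c x = cumul Delta c q /\ cumul Delta c y.+1 = cumul Delta c n.+1].

Lemma extent_ex k (Delta : nat -> 'I_k) q n c :
  cumul Delta c q < cumul Delta c n.+1 -> exists x y, extent Delta q n c x y.
Proof.
move=> lt.
have [x [xn cx ex]] := cumul_index lt.
have lty : (cumul Delta c n.+1).-1 < cumul Delta c n.+1 by lia.
have [y [yn cy ey]] := cumul_index lty.
have Sx : cumul Delta c x.+1 = (cumul Delta c x).+1 by rewrite cumulS cx eqxx addn1.
have Sy : cumul Delta c y.+1 = (cumul Delta c y).+1 by rewrite cumulS cy eqxx addn1.
exists x, y; split=> //.
- by rewrite leqNgt; apply/negP => /(@cumul_le _ Delta c); lia.
- by rewrite leqNgt; apply/negP => /(@cumul_le _ Delta c); lia.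
- by split=> //; lia.
Qed.

Lemma one_heavy_color (Delta : nat -> 'I_3) s r q n A B C :
  1 <= s -> 1 <= r -> 1 <= q -> 3 * s <= 2 * r + 3 ->
  s + 3 * r + q <= n + 3 ->
  avoids Delta s r n ->
  (forall x, cumul Delta A x + cumul Delta B x + cumul Delta C x = x) ->
  cumul Delta B n.+1 < cumul Delta B q + r ->
  cumul Delta C n.+1 < cumul Delta C q + r ->
  forall x y, extent Delta q n A x y -> 3 * s <= y - x + 3.
Proof.
move=> hs hr hq hsr hn hav sum lB lC x y [qx xy yn [cx cy] [ex ey]].
have := sum q; have := sum n.+1 => sn sq.
have cA : s + r + cumul Delta A q <= cumul Delta A n.+1 by lia.
(* [u] and [v] are the s-th and (s+1)-st elements of A from [q] on. *)
have [|u [un cu eu]] := @cumul_index _ Delta A (cumul Delta A q + s.-1) n.+1; first by lia.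
have [|v [vn cv ev]] := @cumul_index _ Delta A (cumul Delta A q + s) n.+1; first by lia.
have Su := cumulS Delta A u; have Sv := cumulS Delta A v; have Sx := cumulS Delta A x.
rewrite cu eqxx in Su; rewrite cv eqxx in Sv; rewrite cx eqxx in Sx.
have xu : x <= u by rewrite leqNgt; apply/negP => /(@cumul_le _ Delta A); lia.
have uv : u < v by rewrite ltnNge; apply/negP => /(@cumul_le _ Delta A); lia.
have vy : v <= y by rewrite leqNgt; apply/negP => /(@cumul_le _ Delta A); lia.
(* At least r elements of A lie in [v, y], so y-v >= r-1 and u-x >= r; hence y-x >= 2r >= 3s-3. *)
have lt : y - v < u - x by apply: (hav A A) => //; lia.
have := sum v; have := sum y.+1.
have := @cumul_le _ Delta B v y.+1; have := @cumul_le _ Delta C v y.+1; lia.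
Qed.

Lemma two_heavy_colors (Delta : nat -> 'I_3) s r q n A B C xA yA xB yB :
  1 <= s -> s <= r -> 1 <= q -> 3 * s <= 2 * r + 2 ->
  s + 3 * r + q <= n + 3 ->
  avoids Delta s r n ->
  (forall x, cumul Delta A x + cumul Delta B x + cumul Delta C x = x) ->
  cumul Delta A q + r <= cumul Delta A n.+1 ->
  cumul Delta B q + r <= cumul Delta B n.+1 ->
  cumul Delta C n.+1 < cumul Delta C q + r ->
  extent Delta q n A xA yA -> extent Delta q n B xB yB ->
  yA - xA + 4 <= 3 * s -> yB - xB + 4 <= 3 * s -> xA < xB -> False.
Proof.
move=> hs hsr hq hsr3 hn hav sum hA hB lC [qxA xyA yAn [cxA cyA] [exA eyA]].
move=> [qxB xyB yBn [cxB cyB] [exB eyB]] dA dB xAB.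
have mA := @cumul_le _ Delta A; have mB := @cumul_le _ Delta B; have mC := @cumul_le _ Delta C.
have sq := sum q; have sn := sum n.+1.
(* Otherwise A and B both lie in [xA, yA], which has at most 3s-3 integers; with at most r-1
   elements of C they cannot fill s+3r-2 positions. *)
have yAB : yA < yB.
  rewrite ltnNge; apply/negP => yBA.
  have := sum xA; have := sum yA.+1.
  have := mB q xA qxA; have := mB xA xB (ltnW xAB); have := mB yA.+1 n.+1 yAn.
  have := mB yB.+1 yA.+1 yBA; have := mC q xA qxA; have := mC yA.+1 n.+1 yAn.
  have := mC xA yA.+1 (leqW xyA); lia.
have bA : cumul Delta B xA = cumul Delta B q.
  by have := mB q xA qxA; have := mB xA xB (ltnW xAB); lia.
have aB : cumul Delta A yB.+1 = cumul Delta A n.+1.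
  by have := mA yA.+1 yB.+1 (leqW yAB); have := mA yB.+1 n.+1 yBn; lia.
have sxA := sum xA; have syB := sum yB.+1; have sxB := sum xB.
have C1 := mC q xA qxA; have C2 := mC xA xB (ltnW xAB); have C3 := mC xB yB.+1 (leqW xyB).
have C4 := mC yB.+1 n.+1 yBn.
(* Outside [xB, yB] there are only C and elements of A before [xB]. The latter number at least
   (s+3r-2)-(3s-3)-(r-1) = 2r-2s+2 >= s. *)
have [|u [un cu eu]] := @cumul_index _ Delta A (cumul Delta A q + s.-1) xB; first by lia.
have Su := cumulS Delta A u; rewrite cu eqxx in Su.
have SxA := cumulS Delta A xA; rewrite cxA eqxx in SxA.
have xAu : xA <= u by rewrite leqNgt; apply/negP => /mA; lia.
have lt : yB - xB < u - xA by apply: (hav A B) => //; lia.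
(* Let d = u-xA and let k count the elements of A strictly between [u] and [xB]. As [xB, yB] has at
   most d integers, s+3r-2 <= s+(r-1)+k+d, so yA-xA >= d+k >= 2r-1 >= 3s-3. *)
have su := sum u; have := mB xA u xAu; have := mB u xB (ltnW un).
have C5 := mC xA u xAu; have C6 := mC u xB (ltnW un).
have A1 := mA u xB (ltnW un); have A2 := mA xB yB.+1 (leqW xyB).
have uyA : u <= yA.
  by rewrite leqNgt; apply/negP => /mA; lia.
have syA := sum yA.+1; have := mC u yA.+1 (leqW uyA).
have := mB u yA.+1 (leqW uyA); lia.
Qed.

Lemma three_heavy_colors (Delta : nat -> 'I_3) s r q n A B C xA yA xB yB xC yC :
  1 <= s -> s <= r -> 1 <= q -> 5 * s <= 3 * r + 3 ->
  s + 3 * r + q <= n + 3 ->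
  avoids Delta s r n ->
  (forall x, cumul Delta A x + cumul Delta B x + cumul Delta C x = x) ->
  cumul Delta B q + r <= cumul Delta B n.+1 ->
  extent Delta q n A xA yA -> extent Delta q n B xB yB -> extent Delta q n C xC yC ->
  yA - xA + 4 <= 3 * s -> yB - xB + 4 <= 3 * s ->
  xA < xB -> xA < xC -> yC < yB -> False.
Proof.
move=> hs hsr hq hsr3 hn hav sum hB [qxA xyA yAn [cxA cyA] [exA eyA]].
move=> [qxB xyB yBn [cxB cyB] [exB eyB]] [qxC xyC yCn [cxC cyC] [exC eyC]] dA dB xAB xAC yCB.
have mA := @cumul_le _ Delta A; have mB := @cumul_le _ Delta B; have mC := @cumul_le _ Delta C.
have sq := sum q; have sn := sum n.+1.
have xAq : xA = q.
  have := sum xA; have := mB q xA qxA; have := mB xA xB (ltnW xAB).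
  by have := mC q xA qxA; have := mC xA xC (ltnW xAC); lia.
(* If [yA] exceeded [yB], then A would span the whole of [q, n], which is too long. *)
have yBn' : yB = n.
  have := sum yB.+1; have := mC yC.+1 yB.+1 (leqW yCB); have := mC yB.+1 n.+1 yBn.
  have [lt|lt] := leqP yB yA; last first.
    by have := mA yA.+1 yB.+1 (leqW lt); have := mA yB.+1 n.+1 yBn; lia.
  have := sum yA.+1; have := mC yC.+1 yA.+1; have := mC yA.+1 n.+1 yAn.
  by have := mB yB.+1 yA.+1; have := mB yA.+1 n.+1 yAn; lia.
subst xA yB => {qxA yBn}.
have lenB : r <= n.+1 - xB.
  by have := sum xB; have := mA xB n.+1; have := mC xB n.+1; lia.
(* The 2s-1 integers of [q, q+2s-2] precede [xB], so A or C occurs s times among them. The equation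
   [e] writes the bound as the difference of endpoints required by [avoids]. *)
have dB' : n - xB < 2 * s - 2.
  have e : q + (2 * s - 2) - q = 2 * s - 2 by lia.
  have Bq := mB q (q + (2 * s - 2)).+1; have Bx := mB (q + (2 * s - 2)).+1 xB.
  have sT := sum (q + (2 * s - 2)).+1.
  rewrite -[X in _ < X]e.
  have [hh|hh] := leqP (cumul Delta A q + s) (cumul Delta A (q + (2 * s - 2)).+1).
    by apply: (hav A B) => //; lia.
  by apply: (hav C B) => //; lia.
(* [p] lies beyond [yA], and [p, p+s-1] still precedes [xB] since 5s <= 3r+3; its s integers all
   have color C. So B would span fewer than s <= r integers. *)
pose p := q + (3 * s - 3).
have e : p + (s - 1) - p = s - 1 by lia.
have : n - xB < s - 1; last by lia.
rewrite -[X in _ < X]e.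
have := mA yA.+1 p; have := mA p (p + (s - 1)).+1; have := mA (p + (s - 1)).+1 n.+1.
have := mB q p; have := mB p (p + (s - 1)).+1; have := mB (p + (s - 1)).+1 xB.
have := sum p; have := sum (p + (s - 1)).+1.
move=> *; apply: (hav C B) => //; lia.
Qed.

(** * Assembly of the upper bound and the theorem *)

Lemma f_prop_upper_bound s r :
  2 <= s -> s <= r -> 5 * s <= 3 * r + 3 -> f_prop s r 3 (4 * s + 3 * r - 4).
Proof.
move=> hs hsr h53; apply: avoids_f_prop => [||Delta hav]; [lia|lia|].
pose q := 3 * s - 1; pose n := 4 * s + 3 * r - 4.
pose heavy c := cumul Delta c q + r <= cumul Delta c n.+1.
have sum A B C : uniq [:: A; B; C] -> _ := @cumul_sum Delta A B C.
pose c0 : 'I_3 := inord 0; pose c1 : 'I_3 := inord 1; pose c2 : 'I_3 := inord 2.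
have u3 : uniq [:: c0; c1; c2] by rewrite /= !inE -!val_eqE /= !inordK.
have [c hc] : exists c, cumul Delta c 1 + s <= cumul Delta c q.
  have := sum _ _ _ u3 1; have := sum _ _ _ u3 q.
  have [?|?] := leqP (cumul Delta c0 1 + s) (cumul Delta c0 q); first by exists c0.
  have [?|?] := leqP (cumul Delta c1 1 + s) (cumul Delta c1 q); first by exists c1.
  by exists c2; lia.
have short c' x y : heavy c' -> extent Delta q n c' x y -> y - x + 4 <= 3 * s.
  move=> hv [qx xy yn [cx cy] [ex ey]].
  (* The first interval is [1, 3s-2], where [c] occurs s times. *)
  have : y - x < 3 * s - 2 - 1; last by lia.
  apply: (hav c c') => //; try lia.
    by have -> : (3 * s - 2).+1 = q by lia.
  by rewrite ex ey.
have ext c' : heavy c' -> exists x y, extent Delta q n c' x y /\ y - x + 4 <= 3 * s.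
  move=> hv; have [|x [y e]] := @extent_ex _ Delta q n c'; first by move: hv; rewrite /heavy; lia.
  by exists x, y; split=> //; apply: short hv e.
have swap12 (A B C : 'I_3) : uniq [:: A; B; C] -> uniq [:: B; A; C].
  by move=> /=; rewrite !inE -!val_eqE /=; lia.
have swap23 (A B C : 'I_3) : uniq [:: A; B; C] -> uniq [:: A; C; B].
  by move=> /=; rewrite !inE -!val_eqE /=; lia.
have startD A B C xA yA xB yB : uniq [:: A; B; C] ->
    extent Delta q n A xA yA -> extent Delta q n B xB yB -> xA <> xB /\ yA <> yB.
  move=> u [_ _ _ [cx cy] _] [_ _ _ [cx' cy'] _].
  have AB : A <> B by move=> AB; move: u; rewrite /= AB inE eqxx.
  by split=> e; apply: AB; [rewrite -cx e|rewrite -cy e].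
have qn : s + 3 * r + q <= n + 3 by lia.
have one A B C : uniq [:: A; B; C] -> heavy A -> heavy B \/ heavy C.
  move=> u hA; have [?|lB] := leqP (cumul Delta B q + r) (cumul Delta B n.+1); first by left.
  right; rewrite /heavy leqNgt; apply/negP => lC.
  have [x [y [e d]]] := ext A hA.
  have := @one_heavy_color Delta s r q n A B C _ _ _ _ qn hav (sum _ _ _ u) lB lC x y e; lia.
have two A B C : uniq [:: A; B; C] -> heavy A -> heavy B -> heavy C.
  move=> u hA hB; rewrite /heavy leqNgt; apply/negP => lC.
  have [x [y [e d]]] := ext A hA; have [x' [y' [e' d']]] := ext B hB.
  have [ne _] := startD _ _ _ _ _ _ _ u e e'.
  have [lt|le] := ltnP x x'.
    apply: (@two_heavy_colors Delta s r q n A B C x y x' y') => //; try lia; exact: sum.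
  apply: (@two_heavy_colors Delta s r q n B A C x' y' x y) => //; try lia.
  exact: sum (swap12 _ _ _ u).
(* A starts first; whichever of B and C ends last plays the role of the final color. *)
have three_min A B C xA yA xB yB xC yC : uniq [:: A; B; C] ->
    heavy B -> heavy C -> extent Delta q n A xA yA -> extent Delta q n B xB yB ->
    extent Delta q n C xC yC -> yA - xA + 4 <= 3 * s ->
    xA < xB -> xA < xC -> False.
  move=> u hB hC eA eB eC dA lB lC.
  have [_ ne] := startD _ _ _ _ _ _ _ (swap23 _ _ _ (swap12 _ _ _ u)) eB eC.
  have [lt|le] := ltnP yC yB.
    apply: (@three_heavy_colors Delta s r q n A B C xA yA xB yB xC yC) => //; try lia.
    - exact: sum.
    - exact: short eB.
  apply: (@three_heavy_colors Delta s r q n A C B xA yA xC yC xB yB) => //; try lia.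
  - exact: sum (swap23 _ _ _ u).
  - exact: short eC.
have three A B C : uniq [:: A; B; C] -> heavy A -> heavy B -> heavy C -> False.
  move=> u hA hB hC.
  have [xA [yA [eA dA]]] := ext A hA; have [xB [yB [eB dB]]] := ext B hB.
  have [xC [yC [eC dC]]] := ext C hC.
  have [n1 _] := startD _ _ _ _ _ _ _ u eA eB.
  have [n2 _] := startD _ _ _ _ _ _ _ (swap23 _ _ _ u) eA eC.
  have [n3 _] := startD _ _ _ _ _ _ _ (swap23 _ _ _ (swap12 _ _ _ u)) eB eC.
  have [?|[?|?]] : xA < xB /\ xA < xC \/ xB < xA /\ xB < xC \/ xC < xA /\ xC < xB by lia.
  - by apply: (three_min A B C) eA eB eC _ _ _ => //; lia.
  - by apply: (three_min B A C) eB eA eC _ _ _ => //; [exact: swap12|lia|lia].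
  - apply: (three_min C A B) eC eA eB _ _ _ => //; [|lia|lia].
    exact/swap12/swap23.
have [A hA] : exists A, heavy A.
  have := sum _ _ _ u3 n.+1; have := sum _ _ _ u3 q.
  have [?|?] := leqP (cumul Delta c0 q + r) (cumul Delta c0 n.+1); first by exists c0.
  have [?|?] := leqP (cumul Delta c1 q + r) (cumul Delta c1 n.+1); first by exists c1.
  by exists c2; rewrite /heavy; lia.
have [B [C u]] : exists B C, uniq [:: A; B; C].
  by case: (A) => [[|[|[|//]]] ?]; [exists c1, c2|exists c0, c2|exists c0, c1];
     rewrite /= !inE -!val_eqE /= !inordK.
have [hB|hC] := one A B C u hA.
  exact: three u hA hB (two _ _ _ u hA hB).
exact: three u hA (two _ _ _ (swap23 _ _ _ u) hA hC) hC.
Qed.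

Theorem theorem4p4 (r s : nat) (hs : 3 <= s) (hrs : s <= r)
    (hlow : (5 * s - 1) %/ 3 - 1 < r) (hup : r <= 2 * s - 2) :
  is_f s r 3 (4 * s + 3 * r - 4).
Proof.
(* The hypothesis [hlow] amounts to 5s <= 3r+3. *)
split; [lia|apply: f_prop_upper_bound; lia|].
by move=> m _; apply: f_prop_lower_bound; lia.
Qed.
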